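(* Let $a_n$ be the number of pop-stacked permutations of $[n]=\{1,\dots,n\}$ and let $F(x)=\sum_{n\ge 0}a_nx^n\in\mathbb{Q}[[x]]$. If $F(x)=p(x)/q(x)$ with $p(x),q(x)\in\mathbb{Q}[x]$ and $q\neq 0$, then $\deg p\ge 500$ or $\deg q\ge 500$.
   Context: For a permutation $\pi=a_1a_2\cdots a_n$ of $[n]$, a descending run of $\pi$ is a maximal sequence of consecutive letters $a_i>a_{i+1}>\cdots>a_{i+j}$. Factor $\pi$ into its descending runs, $\pi=D_1D_2\cdots D_m$; the pop-stack operator $P$ reverses each run: $P(\pi)=D_1^rD_2^r\cdots D_m^r$, where $D^r$ is the reversal of the word $D$. A permutation $\sigma$ of $[n]$ is pop-stacked if $\sigma=P(\pi)$ for some permutation $\pi$ of $[n]$. The empty permutation is counted as pop-stacked, so $a_0=1$. *)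

(* Defs.v *)
From mathcomp Require Import all_boot all_order all_algebra all_fingroup.

Set Implicit Arguments.
Unset Strict Implicit.
Unset Printing Implicit Defensive.

Import GRing.Theory.

Fixpoint descending_runs (w : seq nat) : seq (seq nat) :=
  if w is x :: w' then
    if descending_runs w' is (y :: r) :: rs then
      if y < x then (x :: y :: r) :: rs else [:: x] :: (y :: r) :: rs
    else [:: [:: x]]
  else [::].

(* The next three facts characterize [descending_runs w] as the factorization
   of [w] into nonempty descending factors, with no descent between the end of
   a factor and the start of the next one (maximality). *)
Lemma descending_runs_flatten w : flatten (descending_runs w) = w.
Proof.
elim: w => //= x w; case E: (descending_runs w) => [|[|y r] rs] /=.
- by move <-.
- by case: w E => //= z w; case: descending_runs => [|[|y r] rs'] //; case: ifP.
- by case: ifP => _ /= ->.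
Qed.

Lemma descending_runs_descending w :
  all (fun D => (D != [::]) && sorted gtn D) (descending_runs w).
Proof.
elim: w => //= x w; case: (descending_runs w) => [|[|y r] rs] //=.
by case: ifP => //= ->.
Qed.

Lemma descending_runs_maximal w :
  sorted (fun D E => last 0 D <= head 0 E) (descending_runs w).
Proof.
elim: w => //= x w; case: (descending_runs w) => [|[|y r] rs] //=.
case: ltnP => [_|xy] /=; last by rewrite xy.
by case: rs.
Qed.

Definition pop_stack (w : seq nat) : seq nat :=
  flatten [seq rev D | D <- descending_runs w].

(* One-line notation: the permutation [s] of {0, ..., n-1} stands for the
   permutation a_1 ... a_n of {1, ..., n} with a_(i+1) = s(i) + 1. *)
Definition one_line n (s : 'S_n) : seq nat := [seq (s i).+1 | i <- enum 'I_n].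

Definition pop_stacked n (s : 'S_n) : bool :=
  [exists t : 'S_n, one_line s == pop_stack (one_line t)].

Definition num_pop_stacked (n : nat) : nat := #|[set s : 'S_n | pop_stacked s]|.

(* Formal power series over a ring are represented by their coefficient
   sequences. *)
Definition fps (R : nzRingType) := nat -> R.

Definition fps_mul (R : nzRingType) (f g : fps R) : fps R :=
  fun n => (\sum_(i < n.+1) f i * g (n - i)%N)%R.

Definition fps_of_poly (R : nzRingType) (p : {poly R}) : fps R :=
  fun n => (p`_n)%R.

(* f = p / q in the fraction field of R[[x]], for R an integral domain and
   q != 0. The constant coefficient of q may vanish, so q need not be
   invertible in R[[x]]. *)
Definition fps_eq_ratio (R : idomainType) (f : fps R) (p q : {poly R}) : Prop :=
  fps_mul (fps_of_poly q) f =1 fps_of_poly p.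

Definition pop_stacked_gf : fps rat := fun n => ((num_pop_stacked n)%:R)%R.

(* Main.v *)
Require Import Defs.
From mathcomp Require Import all_boot all_order all_algebra all_fingroup.

(** The series is not rational at all. For every permutation tau of [k], the word
    1 (k+tau(1)) 2 (k+tau(2)) ... k (k+tau(k)) is the image under the pop-stack
    operator of (k+tau(1)) 1 (k+tau(2)) 2 ... (k+tau(k)) k, so a_(2k) >= k!.
    If q F = p with q != 0, the a_n eventually satisfy the linear recurrence read
    off the coefficients of q, so they grow at most exponentially. *)

Set Implicit Arguments.
Unset Strict Implicit.
Unset Printing Implicit Defensive.

Import Order.TTheory GRing.Theory Num.Theory.

Lemma expn_leq_fact m j : m ^ j <= (m + j)`!.
Proof.
elim: j => [|j IHj]; first by rewrite addn0 fact_gt0.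
by rewrite addnS factS expnS leq_mul // -addnS leq_addr.
Qed.

Lemma fact_not_exponentially_bounded b c : exists k, b * c ^ k < k`!.
Proof.
have [->|c_gt0] := posnP c.
  by exists b.+2; rewrite expnS mul0n muln0 fact_gt0.
(* With [k = 2c + j], [k!] is at least [(2c)^j = 2^j * c^j], while [b * c^k = j * c^j]; so [j < 2^j]
   suffices. *)
exists (c.*2 + b * c ^ c.*2); set j := b * c ^ c.*2.
apply: leq_trans (expn_leq_fact _ _).
rewrite expnD mulnA -/j -{1}mul2n expnMn ltn_pmul2r ?expn_gt0 ?c_gt0 //.
exact: ltn_expl.
Qed.

Section PopStackedWords.

Lemma one_line_surj n (w : seq nat) :
  perm_eq w (iota 1 n) -> exists s : 'S_n, one_line s = w.
Proof.
move=> w_perm; pose t := [tuple (val i).+1 | i < n].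
have t_iota : tval t = iota 1 n.
  by rewrite /= -[RHS](map_id) (iotaDl 1 0) -val_enum_ord -!map_comp.
have size_w : size w == n by rewrite (perm_size w_perm) size_iota.
have: perm_eq (Tuple size_w) t by rewrite t_iota.
case/tuple_permP=> s /= ->; exists s; rewrite /one_line.
by apply: eq_map => i; rewrite tnth_mktuple.
Qed.

(** The threshold [m] makes each pair descend and each junction between pairs ascend, so no two
    pairs merge into one run. *)
Lemma descending_runs_pairs m (I : Type) (a b : I -> nat) (r : seq I) :
    (forall i, a i <= m < b i) ->
  descending_runs (flatten [seq [:: b i; a i] | i <- r])
    = [seq [:: b i; a i] | i <- r].
Proof.
move=> ab; have lt_ab i j : a i < b j.
  by case/andP: (ab i) (ab j) => /leq_ltn_trans lt_a _ /andP[_ /lt_a].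
elim: r => //= i r ->; case: r => [|j r] /=; first by rewrite lt_ab.
by rewrite ltnNge ltnW //= lt_ab.
Qed.

Variable k : nat.
Implicit Type tau : 'S_k.

Let low (i : 'I_k) := i.+1.
Let high tau (i : 'I_k) := (k + tau i).+1.

Definition interleaving tau : seq nat :=
  flatten [seq [:: low i; high tau i] | i <- enum 'I_k].

(** All blocks have length two, so the word determines its blocks, and the second letter of block
    [i] gives back [tau i]. *)
Lemma interleaving_inj : injective interleaving.
Proof.
move=> s t /eq_from_flatten_shape; rewrite /shape -!(map_comp size).
move=> /(_ erefl) /eq_in_map eq_st; apply/permP => i; apply: val_inj.
by have /eq_st[/addnI]: i \in enum 'I_k by rewrite mem_enum.
Qed.

Lemma perm_flatten_pairs (I : Type) (a b : I -> nat) (r : seq I) :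
  perm_eq (flatten [seq [:: a i; b i] | i <- r])
          ([seq a i | i <- r] ++ [seq b i | i <- r]).
Proof.
elim: r => //= i r IHr; rewrite perm_cons perm_sym.
by rewrite -cat1s perm_catCA /= perm_cons perm_sym.
Qed.

Lemma perm_low_high tau :
  perm_eq ([seq low i | i <- enum 'I_k] ++ [seq high tau i | i <- enum 'I_k])
          (iota 1 k.*2).
Proof.
rewrite -addnn iotaD; apply: perm_cat.
  by rewrite (iotaDl 1 0) -val_enum_ord -map_comp.
rewrite add1n -[X in iota X _]addn0 iotaDl.
rewrite (map_comp (addn k.+1) (val \o tau)); apply: perm_map.
rewrite -val_enum_ord map_comp; apply/perm_map/uniq_perm; rewrite ?enum_uniq //.
  by rewrite map_inj_uniq ?enum_uniq //; apply: perm_inj.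
move=> i; rewrite mem_enum; apply/mapP; exists (tau^-1 i)%g.
  by rewrite mem_enum.
by rewrite permKV.
Qed.

Lemma interleaving_pop_stacked tau :
  exists2 s : 'S_(k.*2), one_line s = interleaving tau & pop_stacked s.
Proof.
have [|s s_def] := @one_line_surj k.*2 (interleaving tau).
  exact: perm_trans (perm_flatten_pairs _ _ _) (perm_low_high _).
have [|t t_def] :=
  @one_line_surj k.*2 (flatten [seq [:: high tau i; low i] | i <- enum 'I_k]).
  apply: perm_trans (perm_flatten_pairs _ _ _) _.
  by rewrite perm_catC perm_low_high.
exists s => //; apply/existsP; exists t.
rewrite s_def t_def /pop_stack (@descending_runs_pairs k) -?(map_comp rev) // => i.
by rewrite ltn_ord ltnS leq_addr.
Qed.

Lemma fact_leq_num_pop_stacked : k`! <= num_pop_stacked k.*2.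
Proof.
rewrite -card_Sn.
have /fin_all_exists2[f f_word f_pop] := interleaving_pop_stacked.
have f_inj : injective f.
  by move=> s t eq_f; apply: interleaving_inj; rewrite -!f_word eq_f.
rewrite -(card_codom f_inj); apply/subset_leq_card/subsetP => _ /codomP[tau ->].
by rewrite inE.
Qed.

End PopStackedWords.

Section RationalGrowth.

Local Open Scope ring_scope.

Lemma ratio_exponentially_bounded (R : archiRealFieldType) (f : fps R)
    (p q : {poly R}) :
    q != 0 -> fps_eq_ratio f p q ->
  exists b c : nat, forall n, `|f n| <= (b * c ^ n)%:R.
Proof.
move=> q_neq0 qf_p.
(* The constant coefficient of [q] may vanish, so the recurrence is solved for the lowest nonzero
   coefficient. *)
have [v qv_neq0 min_v] : exists2 v, q`_v != 0 & forall i, (i < v)%N -> q`_i = 0.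
  have ex_v : exists i, q`_i != 0 by exists (size q).-1; rewrite lead_coef_eq0.
  case: (ex_minnP ex_v) => v qv min_v; exists v => // i; rewrite ltnNge.
  by apply: contraNeq => /min_v.
pose S := \sum_(i < size q) `|q`_i| / `|q`_v|.
pose B := \sum_(i < size p) `|f i|.
have S_ge0 : 0 <= S by apply: sumr_ge0 => i _; rewrite divr_ge0.
have B_ge0 : 0 <= B by apply: sumr_ge0.
(* The successor makes [c] positive, so [c ^ n] is nondecreasing in [n] and at least 1. *)
pose c := (Num.bound S).+1; pose b := Num.bound B.
have le_Sc : S <= c%:R.
  by rewrite (le_trans (ltW (archi_boundP S_ge0))) // ler_nat leqnSn.
have le_Bb : B <= b%:R by rewrite ltW ?archi_boundP.
exists b, c => n; elim/ltn_ind: n => n IHn.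
have [lt_np|le_pn] := ltnP n (size p).
  apply: le_trans (_ : B <= _).
    by rewrite /B (bigD1 (Ordinal lt_np)) //= lerDl sumr_ge0.
  by rewrite (le_trans le_Bb) // ler_nat leq_pmulr ?expn_gt0.
(* Compare coefficients of degree [v + n] in [q f = p]: that of [p] vanishes since [n >= size p],
   and the term [i = v] is [q_v * f n]. *)
have n_rec : f n =
    - \sum_(i < (v + n).+1 | i != v :> nat) q`_i / q`_v * f (v + n - i)%N.
  have lt_v : (v < (v + n).+1)%N by rewrite ltnS leq_addr.
  have := qf_p (v + n)%N; rewrite /fps_mul /fps_of_poly.
  rewrite [RHS]nth_default ?(leq_trans le_pn) ?leq_addl //.
  rewrite (bigD1 (Ordinal lt_v)) //= addKn => /eqP; rewrite addr_eq0 => /eqP eq_f.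
  apply: (mulfI qv_neq0); rewrite eq_f mulrN mulr_sumr; congr (- _).
  by apply: eq_bigr => i _; rewrite mulrA mulrCA divff // mulr1.
(* Either range may be the longer one; both sums are compared over the larger range, [q] having zero
   coefficients from [size q] on. *)
have S_bound : \sum_(i < (v + n).+1) `|q`_i / q`_v| <= S.
  rewrite /S; set m := (v + n).+1; set N := size q.
  pose g i := `|q`_i / q`_v|.
  have -> : \sum_(i < N) `|q`_i| / `|q`_v| = \sum_(i < maxn N m) g i.
    rewrite (big_ord_widen _ (fun i => `|q`_i| / `|q`_v|) (leq_maxl N m)).
    rewrite big_mkcond; apply: eq_bigr => i _; rewrite /g normf_div.
    by case: ltnP => // le_Ni; rewrite nth_default // normr0 mul0r.
  rewrite (big_ord_widen _ g (leq_maxr N m)) big_mkcond.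
  by apply: ler_sum => i _; case: ifP => // _; apply: normr_ge0.
(* For [n = 0] only indices [i < v] remain, so [f 0 = 0]. Otherwise one factor [c] of [c ^ n.+1]
   absorbs [S]. *)
case: n => [|n] in IHn le_pn n_rec S_bound *.
  rewrite n_rec big1 ?oppr0 ?normr0 // => i neq_iv.
  rewrite min_v ?mul0r // ltn_neqAle neq_iv -ltnS.
  by rewrite (leq_trans (ltn_ord i)) ?addn0.
rewrite n_rec normrN (le_trans (ler_norm_sum _ _ _)) //.
apply: le_trans (_ : S * (b * c ^ n)%:R <= _); last first.
  by rewrite expnS mulnCA [leRHS]natrM ler_wpM2r.
apply: le_trans (ler_wpM2r _ S_bound) => //.
rewrite mulr_suml big_mkcond; apply: ler_sum => i _.
case: ifP => [neq_iv|_]; last by rewrite mulr_ge0.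
(* Terms with [i < v] vanish; those with [i > v] involve only earlier values of [f]. *)
have [lt_iv|lt_vi|eq_iv] := ltngtP i v; last by rewrite eq_iv eqxx in neq_iv.
  by rewrite min_v // !mul0r normr0 mul0r.
have lt_n : (v + n.+1 - i < n.+1)%N by rewrite ltn_subLR ?ltn_add2r // -ltnS.
rewrite normrM ler_wpM2l // (le_trans (IHn _ lt_n)) // ler_nat leq_mul //.
by rewrite leq_pexp2l // -ltnS.
Qed.

End RationalGrowth.

(* (size p).-1 is the degree of p (and 0 for p = 0). *)
Theorem mainTheorem5 (p q : {poly rat}) (hq : q != 0%R)
    (hF : fps_eq_ratio pop_stacked_gf p q) :
  500 <= (size p).-1 \/ 500 <= (size q).-1.
Proof.
have [b [c f_le]] := ratio_exponentially_bounded hq hF.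
(* The base is [c ^ 2] because [k!] bounds the coefficient of index [2k] from below. *)
have [k] := fact_not_exponentially_bounded b (c ^ 2).
rewrite ltnNge -expnM mul2n => /negP[].
apply: leq_trans (fact_leq_num_pop_stacked k) _.
by rewrite -(ler_nat rat) (le_trans _ (f_le _)) // ler_norm.
Qed.
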